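(* Let $m\ge 1$ be an integer, let $u_0,u_1,\dots,u_m$ be a sequence of (compact, nonempty) real intervals with $u_0=u_m=[0,0]$, and let $\lambda_1,\lambda_2\ge 1$ be such that the interval powers $u_i^{\lambda_1}$ and $(\nabla u_i)^{\lambda_2}$ are defined for $1\le i\le m-1$. If $\{u_i\}_{i=0}^m$ is piecewise alternate monotone and piecewise alternate $\mu$-monotone, and $u_i\neq[0,0]$ for every $1\le i\le m-1$, then $$\sum_{i=1}^{m-1}\Big\|u_i^{\lambda_1}\cdot(\nabla u_i)^{\lambda_2}\Big\|\le \frac{\lambda_2\left(\left[\frac m2\right]+1\right)^{\lambda_1}}{\lambda_1+\lambda_2}\sum_{i=1}^{m}\|\nabla u_i\|^{\lambda_1+\lambda_2},$$ where $[\cdot]$ denotes the greatest integer function.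
   Context: An interval is $u=[\underline{u},\overline{u}]=\{t\in\mathbb{R}:\underline{u}\le t\le\overline{u}\}$ with $\underline u\le\overline u$ real; $len(u)=\overline u-\underline u$. Product: $u\cdot v=[\min S,\max S]$ with $S=\{\underline u\,\underline v,\ \underline u\,\overline v,\ \overline u\,\underline v,\ \overline u\,\overline v\}$. gH-difference: $u\ominus_g v=[\min\{\underline u-\underline v,\overline u-\overline v\},\max\{\underline u-\underline v,\overline u-\overline v\}]$. Backward gH-difference operator: $\nabla u_i=u_i\ominus_g u_{i-1}$. Quasi-norm: $\|u\|=\max\{|\underline u|,|\overline u|\}$. Power: $u^{\lambda}=\{t^{\lambda}:t\in u\}$, considered when $t^\lambda$ is defined for all $t\in u$: $\lambda\ge1$ may be any real number if $u\subseteq[0,\infty)$, while $\lambda$ is a positive integer if $u$ contains negative numbers. A sequence $(u_i)$ of intervals is increasing (decreasing) if both real sequences $(\underline{u_i})$ and $(\overline{u_i})$ are increasing (decreasing), in the weak sense. It is $\mu$-increasing ($\mu$-decreasing) if $(len(u_i))$ is increasing (decreasing), weakly. A finite sequence $\{u_i\}_{i=a}^{b}$ is piecewise alternate monotone if there are indices $a=i_0<i_1<\dots<i_k=b$ ($k\ge0$) such that on each block $\{i_{j-1},\dots,i_j\}$ the sequence is increasing or decreasing, with the direction alternating from one block to the next; piecewise alternate $\mu$-monotone is defined in the same way with $\mu$-increasing/$\mu$-decreasing in place of increasing/decreasing. An empty sum is $0$. *)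

(* Defs.v *)
From mathcomp Require Export all_boot all_order all_algebra.
From mathcomp Require Export all_classical all_reals all_analysis.

Set Implicit Arguments.
Unset Strict Implicit.
Unset Printing Implicit Defensive.

Import Order.TTheory GRing.Theory Num.Theory.
Import numFieldNormedType.Exports.

Local Open Scope classical_set_scope.
Local Open Scope ring_scope.

Section Intervals.
Variable R : realType.
Implicit Types x t l : R.

Record cinterval := CInterval { lo : R; hi : R; lo_le_hi : lo <= hi }.

Implicit Types I J : cinterval.

Definition cset I : set R := [set` `[lo I, hi I]].

Definition len I : R := hi I - lo I.

Definition cpoint x : cinterval := CInterval (lexx x).

Lemma cinterval_eq I J : lo I = lo J -> hi I = hi J -> I = J.
Proof.
case: I J => [a b ab] [c d cd] /= ac bd; subst c d.
by rewrite (bool_irrelevance ab cd).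
Qed.

Lemma min_le_max x t : Num.min x t <= Num.max x t.
Proof. by rewrite ge_min !le_max lexx. Qed.

Definition chull x t : cinterval := CInterval (min_le_max x t).

Definition cgH I J : cinterval := chull (lo I - lo J) (hi I - hi J).

Lemma cmul_subproof I J :
  Num.min (Num.min (lo I * lo J) (lo I * hi J))
          (Num.min (hi I * lo J) (hi I * hi J)) <=
  Num.max (Num.max (lo I * lo J) (lo I * hi J))
          (Num.max (hi I * lo J) (hi I * hi J)).
Proof. by rewrite !ge_min !le_max lexx. Qed.

Definition cmul I J : cinterval := CInterval (cmul_subproof I J).

Definition cnorm I : R := Num.max `|lo I| `|hi I|.

(* [powR] is not the usual power on negative reals, hence the case split; both
   branches agree when [t >= 0] and [l] is a natural number. *)
Definition rpow l t : R :=
  if l \is a Num.nat then t ^+ Num.truncn l else t `^ l.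

Definition cpow_defined l I : Prop :=
  1 <= l /\ (cset I `<=` [set t | 0 <= t] \/ l \is a Num.nat).

(* The power of an interval is the image set {t^l : t in I}, given here by its
   end points; [cset_cpow] shows that no other point is added. *)
Definition cpow l I : cinterval :=
  chull (inf (rpow l @` cset I)) (sup (rpow l @` cset I)).

Lemma chull_image (f : R -> R) I a b :
    a \in `[lo I, hi I] -> b \in `[lo I, hi I] ->
    (forall t, t \in `[lo I, hi I] -> f a <= f t <= f b) ->
    (forall y, f a <= y <= f b -> exists2 t, t \in `[lo I, hi I] & f t = y) ->
  cset (chull (inf (f @` cset I)) (sup (f @` cset I))) = f @` cset I.
Proof.
move=> aI bI fab surj.
have nS : f @` cset I !=set0 by exists (f a), a.
have lbS : lbound (f @` cset I) (f a) by move=> _ [t /fab /andP[? ?] <-].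
have ubS : ubound (f @` cset I) (f b) by move=> _ [t /fab /andP[? ?] <-].
have -> : inf (f @` cset I) = f a.
  apply/eqP; rewrite eq_le lb_le_inf// andbT.
  by apply: ge_inf; [exists (f a) | exists a].
have -> : sup (f @` cset I) = f b.
  apply/eqP; rewrite eq_le ge_sup//=.
  by apply: ub_le_sup; [exists (f b) | exists b].
have ab : f a <= f b by have /andP[] := fab a aI => _.
rewrite /cset /chull /= min_l// max_r//.
apply/seteqP; split => y /=.
  by rewrite in_itv /= => /surj[t tI <-]; exists t.
by case=> t /fab tI <-; rewrite in_itv.
Qed.

Lemma cset_cpow l I :
  cpow_defined l I -> cset (cpow l I) = rpow l @` cset I.
Proof.
case=> l1 lI; have loI : lo I \in `[lo I, hi I].
  by rewrite in_itv /= lexx lo_le_hi.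
have hiI : hi I \in `[lo I, hi I] by rewrite in_itv /= lexx lo_le_hi.
have [ln|ln] := boolP (l \is a Num.nat).
  have cf : {within `[lo I, hi I], continuous (rpow l)}.
    apply: continuous_subspaceT => t; rewrite /rpow ln.
    exact: exprn_continuous.
  have [a aI fa] := EVT_min (lo_le_hi I) cf.
  have [b bI fb] := EVT_max (lo_le_hi I) cf.
  apply: (chull_image aI bI) => [t tI|y yab]; first by rewrite fa// fb.
  have {}cf c d : c \in `[lo I, hi I] -> d \in `[lo I, hi I] ->
      {within `[c, d], continuous (rpow l)}.
    move=> cI dI; apply: continuous_subspaceW cf.
    move=> t; rewrite /= !in_itv /= => /andP[ct td].
    by rewrite (le_trans _ ct) ?(itvP cI)// (le_trans td) ?(itvP dI).
  have ab : rpow l a <= rpow l b by case/andP: yab; exact: le_trans.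
  have [le|/ltW le] := leP a b.
    have [|t tI <-] := IVT le (cf _ _ aI bI) (v := y).
      by rewrite min_l// max_r.
    exists t => //; rewrite in_itv /=.
    by rewrite (le_trans _ (_ : a <= t)) ?(itvP aI) ?(itvP tI)//
               (le_trans (_ : t <= b)) ?(itvP bI) ?(itvP tI).
  have [|t tI <-] := IVT le (cf _ _ bI aI) (v := y).
    by rewrite min_r// max_l.
  exists t => //; rewrite in_itv /=.
  by rewrite (le_trans _ (_ : b <= t)) ?(itvP bI) ?(itvP tI)//
             (le_trans (_ : t <= a)) ?(itvP aI) ?(itvP tI).
have {lI} I0 : 0 <= lo I by case: lI => [/(_ _ loI)//|]; rewrite (negPf ln).
have l0 : 0 < l by exact: lt_le_trans l1.
have lp : forall s t : R, 0 <= s -> s <= t -> s `^ l <= t `^ l.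
  by move=> s t s0 st; rewrite ge0_ler_powR// ?nnegrE ?(ltW l0)// (le_trans s0).
have fE t : rpow l t = t `^ l by rewrite /rpow (negPf ln).
apply: (chull_image loI hiI) => [t|y]; rewrite ?fE.
  rewrite in_itv /= => /andP[lt th].
  by rewrite !lp// (le_trans I0).
move=> /andP[ly yh]; have y0 : 0 <= y by rewrite (le_trans _ ly)// powR_ge0.
have yK : (y `^ l^-1) `^ l = y.
  by rewrite -powRrM mulVf ?gt_eqF// powRr1.
exists (y `^ l^-1); rewrite ?fE//.
have lVp : forall s t : R, 0 <= s -> s <= t -> s `^ l^-1 <= t `^ l^-1.
  move=> s t s0 st.
  by rewrite ge0_ler_powR// ?nnegrE ?invr_ge0 ?(ltW l0)// (le_trans s0).
have lK s : 0 <= s -> (s `^ l) `^ l^-1 = s.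
  by move=> s0; rewrite -powRrM mulfV ?gt_eqF// powRr1.
have hi0 : 0 <= hi I by rewrite (le_trans I0)// lo_le_hi.
rewrite in_itv /= -{1}(lK (lo I))// lVp ?powR_ge0//=.
by rewrite -[leRHS](lK (hi I))// lVp.
Qed.

(* Only meaningful for [i > 0]. *)
Definition cnabla (u : nat -> cinterval) (i : nat) : cinterval :=
  cgH (u i) (u i.-1).

Definition increasing_on (p q : nat) (u : nat -> cinterval) : Prop :=
  {in [pred i | p <= i <= q]%N &,
    {homo (fun i => lo (u i)) : i j / (i <= j)%N >-> i <= j}} /\
  {in [pred i | p <= i <= q]%N &,
    {homo (fun i => hi (u i)) : i j / (i <= j)%N >-> i <= j}}.

Definition decreasing_on (p q : nat) (u : nat -> cinterval) : Prop :=
  {in [pred i | p <= i <= q]%N &,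
    {homo (fun i => lo (u i)) : i j / (i <= j)%N >-> j <= i}} /\
  {in [pred i | p <= i <= q]%N &,
    {homo (fun i => hi (u i)) : i j / (i <= j)%N >-> j <= i}}.

Definition mu_increasing_on (p q : nat) (u : nat -> cinterval) : Prop :=
  {in [pred i | p <= i <= q]%N &,
    {homo (fun i => len (u i)) : i j / (i <= j)%N >-> i <= j}}.

Definition mu_decreasing_on (p q : nat) (u : nat -> cinterval) : Prop :=
  {in [pred i | p <= i <= q]%N &,
    {homo (fun i => len (u i)) : i j / (i <= j)%N >-> j <= i}}.

(* The indices are [s 0 < ... < s k]; [d] is the direction on the first block,
   and the block [s j .. s j.+1] has direction [d] iff [j] is even. *)
Definition piecewise_alternate (inc dec : nat -> nat -> Prop)
    (a b : nat) : Prop :=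
  exists (k : nat) (s : nat -> nat) (d : bool),
    [/\ s 0%N = a, s k = b, forall j, (j < k)%N -> (s j < s j.+1)%N
      & forall j, (j < k)%N ->
          if d (+) odd j then inc (s j) (s j.+1) else dec (s j) (s j.+1)].

Definition piecewise_alternate_monotone (a b : nat)
    (u : nat -> cinterval) : Prop :=
  piecewise_alternate (fun p q => increasing_on p q u)
                      (fun p q => decreasing_on p q u) a b.

Definition piecewise_alternate_mu_monotone (a b : nat)
    (u : nat -> cinterval) : Prop :=
  piecewise_alternate (fun p q => mu_increasing_on p q u)
                      (fun p q => mu_decreasing_on p q u) a b.

End Intervals.

(* Main.v *)
Require Import Defs.
From mathcomp Require Import zify ring lra.

(** The statement is a discrete Opial inequality for the real sequences
    [x i = cnorm (u i)] and [d i = cnorm (cnabla u i)].  The quasi-norm is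
    submultiplicative, that of a power is at most the power of the quasi-norm,
    and [`|x i.+1 - x i| <= d i.+1]; hence each term on the left is at most
    [x i `^ l1 * d i `^ l2].  As [x] vanishes at both ends, [x i] is bounded
    both by the sum of [d j] over [j <= i] and by the sum of [d j] over [j > i].
    The first bound is used for [i <= m %/ 2] and the second for the other
    indices, so that only about half of the increments enter each bound: this
    is where the constant [m %/ 2 + 1] comes from.

    On either half one needs [opial_one_end]: if [X i] is at most the sum of the
    increments [y j] for [j < i + c], then
    [(p + q) * \sum_(i < n) X i `^ p * y i `^ q] is at most
    [q * (n + c) `^ p * \sum_(i < n) y i `^ (p + q)].  This goes by induction on
    [n]: Young's inequality bounds the new term, and Bernoulli's inequality
    absorbs what it produces into the growth of [(n + c) `^ p].  The first half
    has [n = m %/ 2] and [c = 1]; the second half, read backwards, has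
    [n = m - m %/ 2 <= m %/ 2 + 1] and [c = 0] because [d i] itself does not
    occur in the bound of [x i].  The better constant for [c = 0] compensates
    for the longer half when [m] is odd. *)

Set Implicit Arguments.
Unset Strict Implicit.
Unset Printing Implicit Defensive.

Import Order.TTheory GRing.Theory Num.Theory.
Import numFieldNormedType.Exports.

Local Open Scope classical_set_scope.
Local Open Scope ring_scope.

(** * Power inequalities *)

Lemma le_powRl (R : realType) (r a b : R) :
  0 <= r -> 0 <= a -> a <= b -> a `^ r <= b `^ r.
Proof.
by move=> r0 a0 ab; rewrite ge0_ler_powR// nnegrE// (le_trans a0).
Qed.

(** Young's inequality for the conjugate exponents [(p + q) / p] and
    [(p + q) / q], with denominators cleared so that [p = 0] makes sense. *)
Lemma weighted_young (R : realType) (a b p q : R) :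
  0 <= a -> 0 <= b -> 0 <= p -> 0 < q ->
  (p + q) * (a `^ p * b `^ q) <= p * a `^ (p + q) + q * b `^ (p + q).
Proof.
move=> a0 b0; rewrite le_eqVlt => /predU1P[<- q0|p0 q0].
  by rewrite powRr0 !add0r mul1r mul0r add0r.
have r0 : 0 < p + q by exact: addr_gt0.
have pN := lt0r_neq0 p0; have qN := lt0r_neq0 q0; have rN := lt0r_neq0 r0.
have := @conjugate_powR R (a `^ p) (b `^ q) ((p + q) / p) ((p + q) / q).
rewrite !powR_ge0 !divr_gt0// => /(_ isT isT isT isT).
have -> : ((p + q) / p)^-1 + ((p + q) / q)^-1 = 1 by field; rewrite pN qN rN.
move=> /(_ erefl); rewrite -!powRrM.
have -> : p * ((p + q) / p) = p + q by field.
have -> : q * ((p + q) / q) = p + q by field.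
rewrite -(ler_pM2l r0) => /le_trans; apply; rewrite le_eqVlt.
by apply/orP; left; apply/eqP; field; rewrite pN qN rN.
Qed.

(** The tangent to [t `^ r] at [a] lies below the graph. *)
Lemma powR_tangent (R : realType) (a b r : R) :
  0 <= a -> 0 <= b -> 1 <= r ->
  r * (a `^ (r - 1) * b) <= (r - 1) * a `^ r + b `^ r.
Proof.
move=> a0 b0 r1; have r10 : 0 <= r - 1 by rewrite subr_ge0.
have := weighted_young a0 b0 r10 ltr01.
by rewrite subrK powRr1// mul1r.
Qed.

(** For [0 < a] this is Bernoulli's inequality at [1 / a], multiplied by
    [a `^ p]; here it follows from the tangent at [a]. *)
Lemma powR_bernoulli (R : realType) (a p : R) :
  0 <= a -> 1 <= p -> a `^ p + p * a `^ (p - 1) <= (a + 1) `^ p.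
Proof.
move=> a0 p1; have := @powR_tangent R a (a + 1) p a0 (addr_ge0 a0 ler01) p1.
have := @mulr_powRB1 R a p a0 (lt_le_trans ltr01 p1); nra.
Qed.

Lemma powR_mean (R : realType) (n : nat) (y : nat -> R) (r : R) :
  (forall j, 0 <= y j) -> 1 <= r -> (0 < n)%N ->
  n%:R * ((\sum_(0 <= j < n) y j) / n%:R) `^ r <= \sum_(0 <= j < n) y j `^ r.
Proof.
move=> y0 r1 n0; have nR0 : 0 < n%:R :> R by rewrite ltr0n.
set a := _ / _; have a0 : 0 <= a by rewrite divr_ge0 ?sumr_ge0.
(* Sum over the [y j] the tangent inequality at their mean [a]. *)
have : \sum_(0 <= j < n) r * (a `^ (r - 1) * y j) <=
       \sum_(0 <= j < n) ((r - 1) * a `^ r + y j `^ r).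
  by apply: ler_sum => j _; exact: powR_tangent.
rewrite -!mulr_sumr big_split /= sumr_const_nat subn0 -mulr_natl.
have -> : \sum_(0 <= j < n) y j = n%:R * a by rewrite /a; field; rewrite gt_eqF.
have := @mulr_powRB1 R a r a0 (lt_le_trans ltr01 r1).
set A := a `^ (r - 1) => <-; lra.
Qed.

(** * Discrete Opial inequalities *)

(** Young's inequality is applied to [b] and to the mean of the [y j], which is
    at least [X / n].  Comparing [b] with the mean rather than with [X] is what
    leaves a factor [n `^ p] only on the power of [b]; by [powR_mean] the power
    of the mean costs one factor [n] less. *)
Lemma young_partial_sum (R : realType) (n : nat) (y : nat -> R) (X b p q : R) :
  (forall j, 0 <= y j) -> 0 <= b -> 1 <= p -> 0 < q ->
  0 <= X <= \sum_(0 <= j < n) y j ->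
  (p + q) * (X `^ p * b `^ q) <=
    p * n%:R `^ (p - 1) * (\sum_(0 <= j < n) y j `^ (p + q)) +
    q * n%:R `^ p * b `^ (p + q).
Proof.
move=> y0 b0 p1 q0 /andP[X0 XS]; have p0 : 0 < p := lt_le_trans ltr01 p1.
case: n XS => [|n] XS.
  have -> : X = 0.
    by move: XS; rewrite big_geq// => XS; apply/eqP; rewrite eq_le XS X0.
  by rewrite powR0 ?gt_eqF// mul0r mulr0 big_geq// !mulr0 mul0r addr0.
set N : R := n.+1%:R; have N0 : 0 < N by rewrite ltr0n.
set S := \sum_(0 <= j < _) y j in XS.
have S0 : 0 <= S / N by exact: divr_ge0 (le_trans X0 XS) (ltW N0).
have pq1 : 1 <= p + q by rewrite ler_wpDr// ltW.
have mean := @powR_mean R n.+1 y (p + q) y0 pq1 isT.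
rewrite -/S -/N in mean.
have XE : X `^ p <= N `^ p * (S / N) `^ p.
  rewrite -powRM ?(ltW N0)// le_powRl ?(ltW p0)//.
  by rewrite mulrCA divff ?mulr1// gt_eqF.
have young := weighted_young S0 b0 (ltW p0) q0.
have NE := mulr_powRB1 (ltW N0) p0.
have Np0 : 0 <= N `^ (p - 1) by exact: powR_ge0.
apply: (@le_trans _ _ (N `^ p * ((p + q) * ((S / N) `^ p * b `^ q)))).
  by rewrite [leRHS]mulrCA ler_pM2l ?addr_gt0// mulrA ler_wpM2r ?powR_ge0.
apply: (le_trans (ler_wpM2l (powR_ge0 _ _) young)).
rewrite mulrDr; apply: lerD; last by rewrite mulrCA mulrA.
rewrite -NE; set s := (\sum_(0 <= j < n.+1) y j `^ (p + q)) in mean *.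
have := ler_wpM2l (mulr_ge0 (ltW p0) Np0) mean; lra.
Qed.

(** The flag [c] tells whether the bound of [X i] includes [y i] itself.  The
    induction closes because [q * M `^ p + p * M `^ (p - 1)] is at most
    [q * (M + 1) `^ p] by Bernoulli's inequality and [1 <= q]. *)
Lemma opial_one_end (R : realType) (c : bool) (n : nat) (X y : nat -> R)
    (p q : R) :
  1 <= p -> 1 <= q -> (forall j, 0 <= y j) ->
  (forall i, (i < n)%N -> 0 <= X i <= \sum_(0 <= j < i + c) y j) ->
  (p + q) * (\sum_(0 <= i < n) X i `^ p * y i `^ q) <=
    q * (n + c)%N%:R `^ p * \sum_(0 <= i < n) y i `^ (p + q).
Proof.
move=> p1 q1 y0; have p0 : 0 < p := lt_le_trans ltr01 p1.
have q0 : 0 < q := lt_le_trans ltr01 q1.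
elim: n => [|n IHn] XS; first by rewrite !big_geq// !mulr0.
have {}IHn := IHn (fun i ltin => XS i (ltnW ltin)).
have step := young_partial_sum y0 (y0 n) p1 q0 (XS n (ltnSn n)).
have bern := @powR_bernoulli R (n + c)%N%:R p (ler0n _ _) p1.
rewrite !(big_nat_recr n)//= addSn.
have S_le : \sum_(0 <= j < n + c) y j `^ (p + q) <=
            \sum_(0 <= i < n) y i `^ (p + q) + y n `^ (p + q).
  case: (c); first by rewrite addn1 big_nat_recr.
  by rewrite addn0 lerDl powR_ge0.
rewrite -[(n + c).+1%:R]natr1.
have := powR_ge0 ((n + c)%N%:R : R) (p - 1).
have := powR_ge0 (y n) (p + q).
have : 0 <= \sum_(0 <= i < n) y i `^ (p + q).
  by apply: sumr_ge0 => i _; exact: powR_ge0.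
move: IHn step S_le bern.
set S := \sum_(0 <= i < n) (X i `^ p * _); set T := X n `^ p * _.
set Q := \sum_(0 <= i < n) _; set Q' := \sum_(0 <= i < n + c) _.
set s := y n `^ _; set A := _ `^ p; set B := _ `^ (p - 1); set C := _ `^ p.
move=> IHn step S_le bern Q0 s0 B0.
have {}step : (p + q) * T <= p * B * (Q + s) + q * A * s.
  by apply: le_trans step _; rewrite lerD2r ler_wpM2l// mulr_ge0// ltW.
have bern' : q * A + p * B <= q * C.
  have : p * B <= q * (p * B) by rewrite ler_peMl// mulr_ge0// ltW.
  by have := ler_wpM2l (ltW q0) bern; lra.
by have := ler_wpM2r (addr_ge0 Q0 s0) bern'; lra.
Qed.

Lemma big_nat_mirror (V : nmodType) (F : nat -> V) (k m : nat) :
  (k <= m)%N ->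
  \sum_(k.+1 <= i < m.+1) F i = \sum_(0 <= i < m - k) F (m - i)%N.
Proof.
move=> km; rewrite -[k.+1]add0n big_addn subSS big_nat_rev.
by apply: eq_big_nat => i /andP[_ ik]; congr F; lia.
Qed.

(** A sequence vanishing at both ends is small near both of them, so
    [opial_one_end] is used from either end up to the middle. *)
Lemma opial_two_ends (R : realType) (m : nat) (x d : nat -> R) (p q : R) :
  1 <= p -> 1 <= q -> (0 < m)%N -> x 0%N = 0 -> x m = 0 ->
  (forall i, 0 <= x i) -> (forall i, `|x i.+1 - x i| <= d i.+1) ->
  (forall i, 0 <= d i) ->
  (p + q) * (\sum_(1 <= i < m) x i `^ p * d i `^ q) <=
    q * ((m %/ 2)%N%:R + 1) `^ p * \sum_(1 <= i < m.+1) d i `^ (p + q).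
Proof.
move=> p1 q1 m0 x0 xm x_ge0 xd d0; set k := (m %/ 2)%N.
have km : (k < m)%N by rewrite /k; lia.
have p0 : 0 <= p := le_trans ler01 p1.
have left_end i : x i.+1 <= \sum_(0 <= j < i + true) d j.+1.
  rewrite addn1; elim: i => [|i IHi].
    by rewrite big_nat1; have := xd 0%N; rewrite x0 subr0 => /ler_normlW.
  by rewrite big_nat_recr//=; have := ler_normlW (xd i.+1); lra.
have right_end i : (i <= m)%N -> x (m - i)%N <= \sum_(0 <= j < i + false) d (m - j)%N.
  rewrite addn0; elim: i => [|i IHi] im; first by rewrite subn0 xm big_geq.
  rewrite big_nat_recr//=; have := IHi (ltnW im).
  have -> : (m - i = (m - i.+1).+1)%N by lia.
  by have := xd (m - i.+1)%N; rewrite distrC => /ler_normlW; lra.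
have first_half := @opial_one_end R true k (fun i => x i.+1) (fun i => d i.+1)
  p q p1 q1 (fun=> d0 _) (fun i _ => introT andP (conj (x_ge0 _) (left_end i))).
have second_half := @opial_one_end R false (m - k)
  (fun i => x (m - i)%N) (fun i => d (m - i)%N) p q p1 q1 (fun=> d0 _)
  (fun i im => introT andP (conj (x_ge0 _)
     (right_end i (leq_trans (ltnW im) (leq_subr _ _))))).
rewrite (@big_cat_nat _ _ _ k.+1 1 m)//= (@big_cat_nat _ _ _ k.+1 1 m.+1)//=;
  last by rewrite ltnS ltnW.
rewrite !mulrDr; apply: lerD.
  by rewrite !big_add1 /=; move: first_half; rewrite addn1 -natr1.
(* The index [m] may be added to the left-hand sum, which makes both sums
   range over the same block. *)
apply: (@le_trans _ _
    ((p + q) * (\sum_(k.+1 <= i < m.+1) x i `^ p * d i `^ q))).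
  rewrite ler_pM2l; last by lra.
  by rewrite big_nat_recr//= lerDl mulr_ge0// powR_ge0.
rewrite !big_nat_mirror ?(ltnW km)//; apply: le_trans second_half _.
rewrite ler_wpM2r ?sumr_ge0// => [i _|]; first exact: powR_ge0.
rewrite ler_wpM2l ?(le_trans ler01)// le_powRl// natr1 ler_nat /k; lia.
Qed.

(** * Quasi-norms of intervals *)

Section IntervalNorm.
Variable R : realType.
Implicit Types (I J : cinterval R) (t l : R).

Lemma cnorm_ge0 I : 0 <= cnorm I.
Proof. by rewrite le_max normr_ge0. Qed.

Lemma le_cnorm I t : t \in `[lo I, hi I] -> `|t| <= cnorm I.
Proof.
rewrite in_itv /= => /andP[lot thi]; rewrite /cnorm le_max.
have [t0|/ltW t0] := leP 0 t; apply/orP; [right|left].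
  by rewrite !ger0_norm// (le_trans t0).
by rewrite !ler0_norm ?lerN2// (le_trans lot).
Qed.

Lemma cnorm_le I (M : R) : `|lo I| <= M -> `|hi I| <= M -> cnorm I <= M.
Proof. by move=> loM hiM; rewrite ge_max loM. Qed.

Lemma cnorm_mul_le I J : cnorm (cmul I J) <= cnorm I * cnorm J.
Proof.
have endI t s : (t = lo I \/ t = hi I) -> (s = lo J \/ s = hi J) ->
    `|t * s| <= cnorm I * cnorm J.
  move=> tI sJ; rewrite normrM ler_pM// le_max.
    by case: tI => ->; rewrite lexx ?orbT.
  by case: sJ => ->; rewrite lexx ?orbT.
apply: cnorm_le => /=.
  by rewrite /Num.min; do !case: ifP => _; apply: endI; auto.
by rewrite /Num.max; do !case: ifP => _; apply: endI; auto.
Qed.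

(** When [l] is not a natural number the points of [I] are nonnegative, so the value of [powR] at
    negative reals does not occur. *)
Lemma norm_rpow_le l I t : cpow_defined l I -> t \in `[lo I, hi I] ->
  `|rpow l t| <= cnorm I `^ l.
Proof.
move=> [l1 Il] tI; have l0 : 0 <= l := le_trans ler01 l1.
have tM := le_cnorm tI; rewrite /rpow; case: ifPn => ln.
  rewrite normrX -[l in leRHS](truncnK ln) powR_mulrn ?cnorm_ge0//.
  by rewrite lerXn2r ?nnegrE ?cnorm_ge0.
have t0 : 0 <= t by case: Il => [/(_ t tI)//|]; rewrite (negPf ln).
by rewrite norm_powR// le_powRl.
Qed.

Lemma cnorm_cpow_le l I : cpow_defined l I -> cnorm (cpow l I) <= cnorm I `^ l.
Proof.
move=> lI; have powI s : s \in `[lo (cpow l I), hi (cpow l I)] ->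
    `|s| <= cnorm I `^ l.
  move=> sI; have : cset (cpow l I) s by [].
  by rewrite cset_cpow// => -[t tI <-]; exact: norm_rpow_le.
have lh := lo_le_hi (cpow l I).
by apply: cnorm_le; apply: powI; rewrite in_itv /= lexx ?andbT; exact: lh.
Qed.

Lemma cnorm_cgH I J : cnorm (cgH I J) = Num.max `|lo I - lo J| `|hi I - hi J|.
Proof.
rewrite /cnorm /cgH /=; case: (leP (lo I - lo J) (hi I - hi J)) => // _.
exact: maxC.
Qed.

Lemma cnorm_dist_le I J : `|cnorm I - cnorm J| <= cnorm (cgH I J).
Proof.
have le_add I1 J1 : cnorm I1 <= cnorm J1 + cnorm (cgH I1 J1).
  have tri (a b : R) : `|a| <= `|b| + `|a - b|.
    by rewrite -{1}(subrKC b a) ler_normD.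
  rewrite cnorm_cgH; apply: cnorm_le.
    by apply: le_trans (tri _ (lo J1)) _; rewrite lerD// le_max lexx.
  by apply: le_trans (tri _ (hi J1)) _; rewrite lerD// le_max lexx orbT.
have sym : cnorm (cgH J I) = cnorm (cgH I J).
  by rewrite !cnorm_cgH distrC [`|hi J - _|]distrC.
by rewrite ler_norml; have := le_add I J; have := le_add J I; rewrite sym; lra.
Qed.

Lemma cnorm_cpoint0 : cnorm (cpoint 0 : cinterval R) = 0.
Proof. by rewrite /cnorm normr0 maxxx. Qed.

End IntervalNorm.

(** * The inequality for intervals *)

Theorem theorem3p12 (R : realType) (m : nat) (u : nat -> cinterval R)
    (l1 l2 : R) (m_ge1 : (1 <= m)%N)
    (u_0 : u 0%N = cpoint 0) (u_m : u m = cpoint 0)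
    (l1_ge1 : 1 <= l1) (l2_ge1 : 1 <= l2)
    (u_pow : forall i, (1 <= i <= m.-1)%N -> cpow_defined l1 (u i))
    (nabla_pow : forall i, (1 <= i <= m.-1)%N -> cpow_defined l2 (cnabla u i))
    (u_mono : piecewise_alternate_monotone 0 m u)
    (u_mu_mono : piecewise_alternate_mu_monotone 0 m u)
    (u_neq0 : forall i, (1 <= i <= m.-1)%N -> u i <> cpoint 0) :
  \sum_(1 <= i < m) cnorm (cmul (cpow l1 (u i)) (cpow l2 (cnabla u i))) <=
    l2 * ((m %/ 2)%N%:R + 1) `^ l1 / (l1 + l2) *
    \sum_(1 <= i < m.+1) cnorm (cnabla u i) `^ (l1 + l2).
Proof.
have l0 : 0 < l1 + l2 by lra.
have opial := @opial_two_ends R m (fun i => cnorm (u i))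
  (fun i => cnorm (cnabla u i)) l1 l2 l1_ge1 l2_ge1 m_ge1.
rewrite /= u_0 u_m !cnorm_cpoint0 in opial.
have {}opial := opial erefl erefl (fun=> cnorm_ge0 _)
  (fun=> cnorm_dist_le _ _) (fun=> cnorm_ge0 _).
rewrite mulrAC ler_pdivlMr// mulrC; apply: le_trans opial.
rewrite ler_pM2l//; apply: ler_sum_nat => i im.
have {}im : (1 <= i <= m.-1)%N by lia.
apply: le_trans (cnorm_mul_le _ _) _.
by rewrite ler_pM ?cnorm_ge0// cnorm_cpow_le//; [exact: u_pow|exact: nabla_pow].
Qed.
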